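(* For every integer $r\ge 3$, there are infinitely many pairwise non-isomorphic finite connected $r$-regular bipartite graphs $G$ whose median eigenvalues are $1$ and $-1$, but which have no eigenvalues in the interval $(-1,1)$, no eigenvalues in the interval $(1,r-2)$, and no eigenvalues in the interval $(-(r-2),-1)$.
   Context: For a finite graph $G$ of order $n$, let $\lambda_1(G)\ge \lambda_2(G)\ge\cdots\ge\lambda_n(G)$ be the eigenvalues of its adjacency matrix. The median eigenvalues of $G$ are $\lambda_{\lfloor (n+1)/2\rfloor}(G)$ and $\lambda_{\lceil (n+1)/2\rceil}(G)$. For $r=3$ the intervals $(1,r-2)$ and $(-(r-2),-1)$ are empty. *)

(* Defs.v *)
From HB Require Import structures.
From mathcomp Require Import all_boot all_order all_algebra.
From mathcomp Require Import polyrcf.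

Set Implicit Arguments.
Unset Strict Implicit.
Unset Printing Implicit Defensive.

Import Order.TTheory GRing.Theory Num.Theory.
Local Open Scope ring_scope.

Record sgraph := SGraph {
  vertex :> finType;
  adj : rel vertex;
  adj_sym : symmetric adj;
  adj_irr : irreflexive adj }.

Definition graph_connected (G : sgraph) : Prop :=
  (0 < #|G|)%N /\ forall x y : G, connect (@adj G) x y.

Definition graph_regular (r : nat) (G : sgraph) : Prop :=
  forall x : G, #|[set y | adj x y]| = r.

Definition graph_bipartite (G : sgraph) : Prop :=
  exists A : {set G}, forall x y : G, adj x y -> (x \in A) != (y \in A).

Definition graph_isomorphic (G H : sgraph) : Prop :=
  exists2 f : G -> H, bijective f & forall x y : G, adj (f x) (f y) = adj x y.

Definition adjmx (R : pzRingType) (G : sgraph) : 'M[R]_#|G| :=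
  \matrix_(i, j) (adj (enum_val i) (enum_val j))%:R.

Definition real_roots (R : rcfType) (p : {poly R}) : seq R :=
  flatten [seq nseq (mup x p) x | x <- rootsR p].

(* In decreasing order, repeated according to multiplicity as roots of the
   characteristic polynomial. *)
Definition spectrum (R : rcfType) (G : sgraph) : seq R :=
  sort >=%R (real_roots (char_poly (adjmx R G))).

(* Indexed from 1; the adjacency matrix being symmetric, the spectrum has #|G|
   elements, so the default value 0 is only reached for k outside 1..#|G|. *)
Definition lambda (R : rcfType) (G : sgraph) (k : nat) : R :=
  nth 0 (spectrum R G) k.-1.

(* The indices are floor((n+1)/2) and ceil((n+1)/2). *)
Definition lower_median_index (G : sgraph) : nat := (#|G|.+1)./2.
Definition upper_median_index (G : sgraph) : nat := uphalf (#|G|.+1).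

Lemma spectrum_eq (R : rcfType) (G : sgraph) (s : seq R) :
  char_poly (adjmx R G) = \prod_(x <- s) ('X - x%:P) ->
  spectrum R G = sort >=%R s.
Proof.
rewrite /spectrum => ->; set p := \prod_(_ <- _) _.
have p0 : p != 0 by rewrite monic_neq0 ?monic_prod_XsubC.
apply/perm_sortP.
- by move=> x y; exact: ge_total.
- by move=> y x z /=; exact: ge_trans.
- by move=> x y /=; exact: ge_anti.
apply/allP => /= x _; apply/eqP; rewrite /real_roots.
rewrite count_flatten -map_comp sumnE big_map.
under eq_bigr => y _ do rewrite /= count_nseq /=.
rewrite -mu_prod_XsubC -/p.
have [px|npx] := boolP (root p x); last first.
  rewrite (mupNroot npx) big1 // => y _.
  by case: eqP => [->|//]; rewrite (mupNroot npx).
have xr : x \in rootsR p by rewrite -roots_on_rootsR // inE px.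
rewrite (bigD1_seq x) //= ?uniq_roots // eqxx mul1n big1 ?addn0 // => y.
by move/negPf->.
Qed.

(* Main.v *)
(**
Let [k = r - 1]. Arrange [n >= 2] copies of K_(k,k) cyclically and join one side
of each copy to the opposite side of the next one by a perfect matching. The
biadjacency matrix is [N = I (x) J + P (x) I], with [J] the all-ones matrix of
order [k] and [P] a cyclic permutation matrix. On vectors whose sum over each
copy is zero [N] is orthogonal, giving the eigenvalues 1 and -1; on vectors
constant on each copy it acts as [k + P], whose singular values are at least
[k - 1 = r - 2]. Bipartiteness makes the spectrum symmetric, so the median
eigenvalues are the eigenvalues of least modulus, namely 1 and -1.
*)

Require Import Defs.
From HB Require Import structures.
From mathcomp Require Import all_boot all_order all_algebra.
From mathcomp Require Import complex reals ring lra.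

Set Implicit Arguments.
Unset Strict Implicit.
Unset Printing Implicit Defensive.

Import Order.TTheory GRing.Theory Num.Theory.
Local Open Scope ring_scope.

(** * Characteristic polynomials under similarity and negation, and for symmetric matrices *)

Lemma char_poly_conj (R : comNzRingType) (n : nat) (P Q A : 'M[R]_n) :
  P *m Q = 1%:M -> char_poly (P *m A *m Q) = char_poly A.
Proof.
move=> PQ1.
have PQ1X : map_mx polyC P *m map_mx polyC Q = 1%:M.
  by rewrite -map_mxM PQ1 map_mx1.
have -> : char_poly (P *m A *m Q) =
    \det (map_mx polyC P *m char_poly_mx A *m map_mx polyC Q).
  congr (\det _); rewrite /char_poly_mx mulmxBr mulmxBl !map_mxM.
  by rewrite scalar_mxC -(mulmxA 'X%:M) PQ1X mulmx1.
by rewrite !det_mulmx mulrAC -det_mulmx PQ1X det1 mul1r.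
Qed.

Lemma char_polyN (R : comNzRingType) (n : nat) (A : 'M[R]_n) :
  char_poly A \Po - 'X = (-1) ^+ n * char_poly (- A).
Proof.
rewrite /char_poly -detZ -(det_map_mx (comp_poly (- 'X))); congr (\det _).
apply/matrixP=> i j; rewrite !mxE rmorphB /= rmorphMn /= comp_polyX comp_polyC.
by rewrite mulN1r polyCN opprK opprD mulNrn.
Qed.

(** Over [R[i]] the matrix is Hermitian, hence unitarily similar to a diagonal matrix with real
    entries; the resulting factorization descends to [R] because the embedding of polynomials is
    injective. *)
Lemma char_poly_symmetric_split (R : rcfType) (n : nat) (A : 'M[R]_n) :
  A^T = A -> exists s : seq R, char_poly A = \prod_(x <- s) ('X - x%:P).
Proof.
move=> symA; pose f := real_complex R.
have Aherm : map_mx f A \is hermsymmx.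
  apply: realsym_hermsym.
    by apply/is_hermitianmxP; rewrite expr0 scale1r map_mx_id // map_trmx symA.
  by apply/mxOverP=> i j; rewrite mxE complex_real.
have /orthomx_spectralP/= eA := hermitian_normalmx Aherm.
have /mxOverP dreal := hermitian_spectral_diag_real Aherm.
set d := spectral_diag _ in eA dreal.
exists [seq complex.Re (d 0 i) | i <- enum 'I_n].
apply: (map_poly_inj f); rewrite map_char_poly {1}eA.
rewrite char_poly_conj; last exact/mulVmx/spectral_unit.
rewrite char_poly_trig ?diag_mx_is_trig // big_map rmorph_prod big_enum /=.
apply: eq_bigr => i _; rewrite rmorphB /= map_polyX map_polyC mxE eqxx mulr1n.
congr ('X - _%:P); exact/esym/RRe_real/dreal.
Qed.

(** * Adjacency spectra and their symmetry for bipartite graphs *)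

Lemma eigenvalue_adjmxP (R : fieldType) (G : sgraph) (x : R) :
  eigenvalue (adjmx R G) x <->
  exists2 f : G -> R, (exists y, f y != 0) &
    forall y, \sum_(z | adj y z) f z = x * f y.
Proof.
split=> [/eigenvalueP[v /rowP eqv v0]|[f [y fy0] eqf]].
  exists (fun y => v 0 (enum_rank y)).
    have /rV0Pn[i vi0] := v0.
    by exists (enum_val i); rewrite enum_valK.
  move=> y; have := eqv (enum_rank y); rewrite !mxE => <-.
  rewrite (reindex (@enum_val _ predT)) /=; last first.
    by apply: onW_bij; exact: enum_val_bij.
  rewrite big_mkcond; apply: eq_bigr => i _.
  rewrite mxE enum_rankK adj_sym enum_valK.
  by case: adj; rewrite ?mulr1 ?mulr0.
apply/eigenvalueP; exists (\row_i f (enum_val i)); last first.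
  by apply/rV0Pn; exists (enum_rank y); rewrite mxE enum_rankK.
apply/rowP=> i; rewrite !mxE -eqf.
rewrite [RHS](reindex (@enum_val _ predT)) /=; last first.
  by apply: onW_bij; exact: enum_val_bij.
rewrite [RHS]big_mkcond; apply: eq_bigr => j _.
by rewrite !mxE adj_sym; case: adj; rewrite ?mulr1 ?mulr0.
Qed.

(** Conjugation by the diagonal matrix of signs of the bipartition changes the sign of every entry,
    since edges join vertices of opposite sign. *)
Lemma char_poly_bipartite (R : comNzRingType) (G : sgraph) :
  graph_bipartite G -> char_poly (- adjmx R G) = char_poly (adjmx R G).
Proof.
case=> A Abip.
pose D : 'M[R]_#|G| := diag_mx (\row_i (-1) ^+ (enum_val i \in A)).
have DD : D *m D = 1%:M.
  rewrite mulmx_diag -diag_const_mx; congr diag_mx.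
  by apply/rowP=> i; rewrite !mxE -expr2 sqrr_sign.
rewrite -(char_poly_conj _ DD); congr char_poly.
rewrite mul_diag_mx mul_mx_diag; apply/matrixP=> i j; rewrite !mxE. 
case: (boolP (adj _ _)) => [/Abip|_]; last by rewrite mulr0n oppr0 mulr0 mul0r.
by case: (_ \in A); case: (_ \in A); rewrite // mulr1n ?mul1r ?mulr1 ?mulrNN ?mulr1.
Qed.

Lemma spectrum_size (R : rcfType) (G : sgraph) : size (spectrum R G) = #|G|.
Proof.
have [|s es] := @char_poly_symmetric_split R _ (adjmx R G).
  by apply/matrixP=> i j; rewrite !mxE adj_sym.
rewrite (spectrum_eq es) size_sort; apply: succn_inj.
by rewrite -(size_prod_XsubC _ id) -es size_char_poly.
Qed.

Lemma mem_spectrum (R : rcfType) (G : sgraph) (x : R) :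
  (x \in spectrum R G) = eigenvalue (adjmx R G) x.
Proof.
have [|s es] := @char_poly_symmetric_split R _ (adjmx R G).
  by apply/matrixP=> i j; rewrite !mxE adj_sym.
by rewrite (spectrum_eq es) mem_sort eigenvalue_root_char es root_prod_XsubC.
Qed.

(** The multiset of roots is stable under negation, and both lists are decreasing, so they
    coincide. *)
Lemma spectrum_bipartite (R : rcfType) (G : sgraph) : graph_bipartite G ->
  spectrum R G = rev [seq - x | x <- spectrum R G].
Proof.
move=> bipG.
have [|s es] := @char_poly_symmetric_split R _ (adjmx R G).
  by apply/matrixP=> i j; rewrite !mxE adj_sym.
have ss : size s = #|G| by rewrite -(spectrum_size R) (spectrum_eq es) size_sort.
have symm : perm_eq s [seq - x | x <- s].
  apply/prod_XsubC_eq; rewrite -es -(char_poly_bipartite R bipG).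
  (* The sign turns the left side into a composition with [- 'X]; there each factor is minus
     ['X + x], which absorbs the sign again. *)
  apply: (@mulfI _ ((-1) ^+ #|G|)); first by rewrite signr_eq0.
  rewrite -char_polyN es rmorph_prod big_map -ss; elim: (s) => [|x s' IHs] /=.
    by rewrite !big_nil mulr1.
  rewrite !big_cons IHs rmorphB /= comp_polyX comp_polyC polyCN exprS opprK.
  by rewrite mulrACA mulN1r opprD.
rewrite (spectrum_eq es); apply: (@sorted_eq _ >=%R).
- by move=> y x z /=; exact: ge_trans.
- by move=> x y /=; exact: ge_anti.
- by apply: sort_sorted => x y; exact: ge_total.
- rewrite rev_sorted sorted_map.
  rewrite (@eq_sorted _ _ >=%R) => [|x y /=]; last by rewrite lerN2.
  by apply: sort_sorted => x y; exact: ge_total.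
rewrite perm_sym perm_rev perm_sym perm_sort (permPl symm) perm_map //.
by rewrite perm_sym perm_sort.
Qed.

(* The two middle entries of the symmetric spectrum are opposite, so the upper one
   is nonnegative, hence at least [c]; were it larger, [c] would lie below the
   lower one, which is negative. *)
Lemma bipartite_median (R : rcfType) (G : sgraph) (c : R) :
    graph_bipartite G -> ~~ odd #|G| -> 0 < c ->
    eigenvalue (adjmx R G) c ->
    (forall x, eigenvalue (adjmx R G) x -> c <= `|x|) ->
  lambda R G (lower_median_index G) = c /\
  lambda R G (upper_median_index G) = - c.
Proof.
move=> bipG evenG c_gt0 eigc lbc; rewrite /lambda.
set t := spectrum R G.
have st : size t = #|G| := spectrum_size R G.
have ct : c \in t by rewrite mem_spectrum.
pose m := #|G|./2.
have eG : #|G| = m.*2 by rewrite -[LHS]odd_double_half (negbTE evenG).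
(* With [m.*2] vertices the medians sit at the 0-based positions [m.-1] and [m], which reversal
   exchanges. *)
have -> : lower_median_index G = m.
  by rewrite /lower_median_index eG -[_./2]/(uphalf _) uphalf_double.
have -> : upper_median_index G = m.+1.
  by rewrite /upper_median_index eG /= half_double.
have m_gt0 : (0 < m)%N by rewrite -double_gt0 -eG -st; case: (t) ct.
have lt_m1 : (m.-1 < size t)%N.
  by rewrite st eG prednK // -addnn leq_addr.
have lt_m : (m < size t)%N.
  by rewrite st eG -addnn -[X in (X < _)%N]addn0 ltn_add2l.
have opp_mid : nth 0 t m.-1 = - nth 0 t m.
  have rev_mid : (size t - m.-1.+1 = m)%N by rewrite prednK // st eG -addnn addnK.
  rewrite {1}/t spectrum_bipartite // -/t nth_rev ?size_map // rev_mid.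
  by rewrite (nth_map 0).
have t_sorted : sorted >=%R t by apply: sort_sorted => x y; exact: ge_total.
have tmono i j : (i <= j)%N -> (j < size t)%N -> nth 0 t j <= nth 0 t i.
  move=> ij jt; apply: (sorted_leq_nth _ _ _ t_sorted) => //.
  - by move=> y x z /=; exact: ge_trans.
  - by move=> x /=; exact: lexx.
  - by rewrite inE (leq_ltn_trans ij).
have mid_ge : c <= nth 0 t m.-1.
  have ge0 : 0 <= nth 0 t m.-1 by have := tmono _ _ (leq_pred m) lt_m; lra.
  by rewrite -[leRHS]ger0_norm //; apply: lbc; rewrite -mem_spectrum mem_nth.
have mid : nth 0 t m.-1 = c.
  apply/le_anti; rewrite mid_ge andbT -(nth_index 0 ct).
  have [ltim|leim] := ltnP (index c t) m.
    by apply: tmono; rewrite // -ltnS prednK.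
  have := tmono _ _ leim; rewrite index_mem => /(_ ct).
  by rewrite nth_index //; lra.
by rewrite /= mid; split=> //; rewrite -mid opp_mid opprK.
Qed.

(** * The necklaces: regularity, bipartition, connectedness *)

Section NecklaceGraph.
Variables n k : nat.

Definition necklace_step (b : bool) (i : 'I_n.+2) : 'I_n.+2 :=
  if b then i + 1 else i - 1.

(* Copies of K_(k,k) indexed by Z/(n+2); the side [true] of copy [i] is moreover
   matched with the side [false] of copy [i + 1]. *)
Definition necklace_adj : rel (bool * ('I_n.+2 * 'I_k)) := fun p q =>
  (q.1 == ~~ p.1) &&
  ((q.2.1 == p.2.1) || (q.2 == (necklace_step p.1 p.2.1, p.2.2))).

Lemma necklace_stepK (b : bool) : cancel (necklace_step b) (necklace_step (~~ b)).
Proof. by case: b => i; rewrite /necklace_step /= (addrK, subrK). Qed.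

Lemma necklace_step_neq (b : bool) (i : 'I_n.+2) : necklace_step b i != i.
Proof.
(* At least two copies are needed here, whence the index type ['I_n.+2]. *)
have one0 : (1 : 'I_n.+2) != 0 by [].
by case: b; rewrite /necklace_step -subr_eq0 addrAC subrr add0r ?oppr_eq0.
Qed.

Lemma necklace_adj_sym : symmetric necklace_adj.
Proof.
suff sub p q : necklace_adj p q -> necklace_adj q p.
  by move=> p q; apply/idP/idP; exact: sub.
case: p q => b [i a] [c [j d]] /andP[/= /eqP-> h].
rewrite /necklace_adj /= negbK eqxx; case/orP: h => [/eqP->|/eqP[-> ->]].
  by rewrite eqxx.
by rewrite necklace_stepK eqxx orbT.
Qed.

Lemma necklace_adj_irr : irreflexive necklace_adj.
Proof. by case=> -[] p. Qed.

Definition necklace : sgraph := SGraph necklace_adj_sym necklace_adj_irr.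

Lemma necklace_neighbors (b : bool) (i : 'I_n.+2) (a : 'I_k) :
  [set z | @adj necklace (b, (i, a)) z] =
  (~~ b, (necklace_step b i, a)) |: [set (~~ b, (i, d)) | d : 'I_k].
Proof.
apply/setP=> -[c [j d]]; rewrite !inE /adj /= /necklace_adj /= andb_orr orbC.
congr orb; apply/andP/imsetP => /= [[/eqP-> /eqP->]|[e _ [-> -> _]]] //.
by exists d.
Qed.

Lemma necklace_neighbors_notin (b : bool) (i : 'I_n.+2) (a : 'I_k) :
  (~~ b, (necklace_step b i, a)) \notin [set (~~ b, (i, d)) | d : 'I_k].
Proof.
apply/imsetP=> -[d _ [/eqP]].
by rewrite (negbTE (necklace_step_neq b i)).
Qed.

Lemma necklace_inj (b : bool) (i : 'I_n.+2) :
  injective (fun d : 'I_k => (b, (i, d))).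
Proof. by move=> d e []. Qed.

Lemma necklace_sum_neighbors (V : nmodType) (f : necklace -> V)
    (b : bool) (i : 'I_n.+2) (a : 'I_k) :
  \sum_(z | @adj necklace (b, (i, a)) z) f z =
  f (~~ b, (necklace_step b i, a)) + \sum_(d < k) f (~~ b, (i, d)).
Proof.
transitivity (\sum_(z in [set z | @adj necklace (b, (i, a)) z]) f z).
  by apply: eq_bigl => z; rewrite inE.
rewrite necklace_neighbors big_setU1 ?necklace_neighbors_notin //=.
by rewrite big_imset //= => d e _ _; exact: necklace_inj.
Qed.

Lemma necklace_regular : graph_regular k.+1 necklace.
Proof.
move=> [b [i a]]; rewrite necklace_neighbors cardsU1 necklace_neighbors_notin.
by rewrite card_imset ?card_ord //; exact: necklace_inj.
Qed.

Lemma necklace_bipartite : graph_bipartite necklace.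
Proof.
exists [set z : necklace | z.1] => -[b p] [c q] /andP[/= /eqP-> _].
by rewrite !inE /=; case: b.
Qed.

Lemma card_necklace : #|necklace| = (n.+2 * k).*2.
Proof. by rewrite !card_prod card_bool !card_ord mul2n. Qed.

Lemma necklace_connected : (0 < k)%N -> graph_connected necklace.
Proof.
move=> k_gt0; split; first by rewrite card_necklace double_gt0 muln_gt0.
pose a0 : 'I_k := Ordinal k_gt0.
pose conn := connect (@adj necklace).
have connC : connect_sym (@adj necklace).
  by apply: sym_connect_sym; exact: adj_sym.
have cross b i a d : conn (b, (i, a)) (~~ b, (i, d)).
  by apply: connect1; rewrite /adj /= /necklace_adj /= !eqxx.
have block b c i a d : conn (b, (i, a)) (c, (i, d)).
  have [->|] := eqVneq c (~~ b); first exact: cross.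
  have -> : (c != ~~ b) = (c == b) by case: b; case: c.
  move/eqP->; apply: connect_trans (cross b i a a) _.
  by have := cross (~~ b) i a d; rewrite negbK.
have reach m : conn (true, (0, a0)) (true, (m%:R, a0)).
  elim: m => [|m IHm]; first exact: connect0.
  (* A matching edge leads to the side [false] of the next copy, and [block] returns to the side
     [true]. *)
  apply: connect_trans IHm _; apply: connect_trans (block false true _ a0 a0).
  apply: connect1; rewrite /adj /= /necklace_adj /= -natr1.
  by rewrite /necklace_step eqxx orbT.
have root p : conn (true, (0, a0)) p.
  case: p => b [j a]; rewrite -(natr_Zp (j : 'Z_n.+2)).
  exact: connect_trans (reach _) (block _ _ _ _ _).
by move=> p q; apply: connect_trans (root q); rewrite connC; exact: root.
Qed.

(** * Eigenvalues of the necklaces *)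

Lemma necklace_eigenvalue1 (R : fieldType) :
  (1 < k)%N -> eigenvalue (adjmx R necklace) 1.
Proof.
move=> k_gt1; pose a0 : 'I_k := Ordinal (ltnW k_gt1).
pose a1 : 'I_k := Ordinal k_gt1.
apply/eigenvalue_adjmxP.
(* This vector sums to zero on every side, so only the matching edge contributes, and it preserves
   the value. *)
exists (fun p : necklace => (p.2.2 == a0)%:R - (p.2.2 == a1)%:R).
  by exists (true, (0, a0)); rewrite /= subr0 oner_eq0.
move=> [b [i a]]; rewrite necklace_sum_neighbors mul1r /= sumrB.
have sum1 (c : 'I_k) : \sum_(d < k) (d == c)%:R = 1 :> R.
  by rewrite (bigD1 c) //= eqxx big1 ?addr0 // => d /negbTE->.
by rewrite !sum1 subrr addr0.
Qed.

(* The sums [S] of an eigenvector over the sides of the K_(k,k)'s satisfy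
   [x S = k S' + P S'] with [P] a permutation, so [|x| >= k - 1] unless [S = 0];
   if [S = 0], the adjacency matrix acts as an involution. *)
Lemma necklace_eigenvalue_gap (R : realFieldType) (x : R) :
  eigenvalue (adjmx R necklace) x ->
  x ^+ 2 = 1 \/ (k%:R - 1) ^+ 2 <= x ^+ 2.
Proof.
move=> /eigenvalue_adjmxP[f [[b0 [i0 a0]] f0] eqf].
pose S (b : bool) (i : 'I_n.+2) := \sum_(d < k) f (b, (i, d)).
have eqf' b i a : x * f (b, (i, a)) =
    f (~~ b, (necklace_step b i, a)) + S (~~ b) i.
  by rewrite -eqf necklace_sum_neighbors.
have eqS b i : x * S b i = S (~~ b) (necklace_step b i) + k%:R * S (~~ b) i.
  rewrite /S mulr_sumr (eq_bigr _ (fun d _ => eqf' b i d)) big_split /=.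
  by rewrite sumr_const card_ord mulr_natl.
pose Q := \sum_b \sum_i S b i ^+ 2.
have Q_ge0 : 0 <= Q.
  by apply: sumr_ge0 => b _; apply: sumr_ge0 => i _; exact: sqr_ge0.
have [Q0|Q_neq0] := eqVneq Q 0.
  left; have S0 b i : S b i = 0.
    have /eqP := Q0; rewrite psumr_eq0 => [/allP/(_ b)|c _]; last first.
      by apply: sumr_ge0 => j _; exact: sqr_ge0.
    rewrite mem_index_enum => /(_ isT).
    rewrite psumr_eq0 => [/allP/(_ i)|j _]; last exact: sqr_ge0.
    by rewrite mem_index_enum => /(_ isT); rewrite sqrf_eq0 => /eqP.
  apply: (mulIf f0); rewrite mul1r expr2 -mulrA eqf' S0 addr0 eqf' S0 addr0.
  by rewrite necklace_stepK negbK.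
right; have Q_gt0 : 0 < Q by rewrite lt0r Q_neq0.
rewrite -(ler_pM2r Q_gt0).
(* Switching sides and stepping along the matching both permute the pairs [(b, i)]. *)
have Qstep : \sum_b \sum_i S (~~ b) (necklace_step b i) ^+ 2 = Q.
  rewrite /Q [RHS](reindex_inj negb_inj) /=; apply: eq_bigr => b _.
  rewrite [RHS](reindex_inj (can_inj (necklace_stepK b))) /=; exact: eq_bigr.
have Qneg : \sum_b \sum_i S (~~ b) i ^+ 2 = Q.
  by rewrite /Q [RHS](reindex_inj negb_inj).
have -> : x ^+ 2 * Q = \sum_b \sum_i (x * S b i) ^+ 2.
  rewrite mulr_sumr; apply: eq_bigr => b _; rewrite mulr_sumr.
  by apply: eq_bigr => i _; rewrite exprMn.
(* The weights add up to [(k - 1)^2], and are chosen so that each term falls short of the square of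
   [S' + k S] by exactly [k (S + S')^2]. *)
have -> : (k%:R - 1) ^+ 2 * Q =
    \sum_b \sum_i ((k%:R ^+ 2 - k%:R) * S (~~ b) i ^+ 2 +
                   (1 - k%:R) * S (~~ b) (necklace_step b i) ^+ 2).
  under eq_bigr => b _ do rewrite big_split /= -!mulr_sumr.
  by rewrite big_split /= -!mulr_sumr Qstep Qneg; ring.
apply: ler_sum => b _; apply: ler_sum => i _; rewrite eqS.
have k_ge0 : 0 <= k%:R :> R by [].
have := mulr_ge0 k_ge0 (sqr_ge0 (S (~~ b) (necklace_step b i) + S (~~ b) i)).
rewrite -[in X in _ -> X]subr_ge0; congr (is_true (0 <= _)); ring.
Qed.

End NecklaceGraph.

(** * The infinite family for a given degree *)

Theorem theorem4 (R : realType) (r : nat) (hr : (3 <= r)%N) :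
  exists G : nat -> sgraph,
    (forall i j : nat, i <> j -> ~ graph_isomorphic (G i) (G j)) /\
    (forall i : nat,
      [/\ graph_connected (G i), graph_regular r (G i) & graph_bipartite (G i)] /\
      (lambda R (G i) (lower_median_index (G i)) = 1 /\
       lambda R (G i) (upper_median_index (G i)) = -1) /\
      forall x : R, eigenvalue (adjmx R (G i)) x ->
        [/\ ~ (-1 < x < 1),
            ~ (1 < x < r%:R - 2) &
            ~ (- (r%:R - 2) < x < -1)]).
Proof.
have k_gt1 : (1 < r.-1)%N by case: r hr.
have k_gt0 := ltnW k_gt1.
have er : r%:R - 2 = r.-1%:R - 1 :> R.
  by rewrite -{1}(prednK (ltnW (ltnW hr))) -natr1; ring.
have c_ge1 : 1 <= r%:R - 2 :> R by rewrite er lerBrDr (ler_nat _ 2).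
exists (fun m => necklace m r.-1); split=> [i j ij [f bijf _]|i].
  (* The orders [2 (m + 2) (r - 1)] are pairwise distinct. *)
  apply: ij; have := bij_eq_card bijf; rewrite !card_necklace => /double_inj/eqP.
  by rewrite eqn_pmul2r // => /eqP[].
have gap x : eigenvalue (adjmx R (necklace i r.-1)) x ->
    x ^+ 2 = 1 \/ (r%:R - 2) ^+ 2 <= x ^+ 2.
  by rewrite er; exact: necklace_eigenvalue_gap.
split.
  split; [exact: necklace_connected| |exact: necklace_bipartite].
  by have := @necklace_regular i r.-1; rewrite prednK // (ltnW (ltnW hr)).
split.
  apply: bipartite_median => //.
  - exact: necklace_bipartite.
  - by rewrite card_necklace odd_double.
  - exact: necklace_eigenvalue1.
  (* Moduli are compared through squares; [r - 2 >= 1] settles the second alternative. *)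
  move=> x /gap x_gap; rewrite -(@ler_pXn2r _ 2) ?nnegrE // -normrX.
  by rewrite ger0_norm ?sqr_ge0 // expr1n; case: x_gap => [->//|]; nra.
by move=> x /gap[]; split=> /andP[]; nra.
Qed.
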